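(* For $x$ and $y$ such that both sides converge, $${}_{3}F_{2}\!\left[\begin{matrix}x,\,x+1,\,1\\ x+y,\,x+y+1\end{matrix}\,\Bigg|\,1\right]=\frac{2x+3y-1}{2(2y-1)}+\frac{(y-1)y(y+1)}{2(2y-1)(x+y)(x+y+1)}\cdot{}_{3}F_{2}\!\left[\begin{matrix}x,\,x+1,\,1\\ x+y+1,\,x+y+2\end{matrix}\,\Bigg|\,1\right].$$
   Context: ${}_{p}F_{q}\!\left[\begin{matrix}a_1,\dots,a_p\\ b_1,\dots,b_q\end{matrix}\,\Big|\,z\right]=\sum_{k=0}^{\infty}\frac{(a_1)_k\cdots(a_p)_k}{(b_1)_k\cdots(b_q)_k}\frac{z^k}{k!}$ is the generalized hypergeometric series, where $(a)_k=a(a+1)\cdots(a+k-1)$ is the Pochhammer symbol. *)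

(* Defs.v *)
From Stdlib Require Import Reals List Factorial.
From Coquelicot Require Import Coquelicot.
Import ListNotations.

Open Scope R_scope.
Open Scope C_scope.

Fixpoint pochhammer (a : C) (k : nat) : C :=
  match k with
  | O => 1
  | S k' => pochhammer a k' * (a + INR k')
  end.

Definition Cprod (l : list C) : C := fold_right Cmult 1 l.

Definition hypergeom_term (a b : list C) (z : C) (k : nat) : C :=
  Cprod (map (fun ai => pochhammer ai k) a)
  / Cprod (map (fun bj => pochhammer bj k) b)
  * (Cpow z k / INR (fact k)).

(* Division is total on [C], so convergence has to include that every term is
   meaningful: no denominator (b_j)_k vanishes, i.e. no lower parameter is a
   non-positive integer. *)
Definition hypergeom_cvg (a b : list C) (z : C) : Prop :=
  (forall bj, In bj b -> forall k : nat, pochhammer bj k <> 0) /\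
  ex_series (V := C_NormedModule) (hypergeom_term a b z).

(* Coquelicot's sum operator [Series] is real-valued, so a complex series is
   summed componentwise; see [hypergeom_correct]. *)
Definition hypergeom (a b : list C) (z : C) : C :=
  (Series (fun k => fst (hypergeom_term a b z k)),
   Series (fun k => snd (hypergeom_term a b z k))).

Lemma fst_sum_n (u : nat -> C) (n : nat) :
  fst (sum_n (G := C_NormedModule) u n) = sum_n (fun k => fst (u k)) n.
Proof.
  induction n as [|n IH].
  - now rewrite !sum_O.
  - rewrite !sum_Sn, <- IH. reflexivity.
Qed.

Lemma snd_sum_n (u : nat -> C) (n : nat) :
  snd (sum_n (G := C_NormedModule) u n) = sum_n (fun k => snd (u k)) n.
Proof.
  induction n as [|n IH].
  - now rewrite !sum_O.
  - rewrite !sum_Sn, <- IH. reflexivity.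
Qed.

Lemma is_series_C_unique (u : nat -> C) (l : C) :
  is_series (V := C_NormedModule) u l ->
  (Series (fun k => fst (u k)), Series (fun k => snd (u k))) = l.
Proof.
  intros H. destruct l as [l1 l2].
  assert (H' : forall eps : posreal, eventually (fun n =>
     ball (M := C_UniformSpace) (l1, l2) eps
       (sum_n (G := C_NormedModule) u n))).
  { apply (proj1 (filterlim_locally (F := eventually)
      (sum_n (G := C_NormedModule) u) ((l1, l2) : C_UniformSpace))).
    exact H. }
  f_equal; apply is_series_unique; apply (proj2 (filterlim_locally _ _));
    intros eps; generalize (H' eps); apply filter_imp; intros n [H1 H2].
  - rewrite fst_sum_n in H1. exact H1.
  - rewrite snd_sum_n in H2. exact H2.
Qed.

Lemma hypergeom_correct (a b : list C) (z : C) :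
  hypergeom_cvg a b z ->
  is_series (V := C_NormedModule) (hypergeom_term a b z) (hypergeom a b z).
Proof.
  intros [_ [l Hl]]. unfold hypergeom.
  now rewrite (is_series_C_unique _ _ Hl).
Qed.

(* Main.v *)
Require Import Defs.
From Stdlib Require Import Reals List Factorial Lra Lia.
From Coquelicot Require Import Coquelicot.
Import ListNotations.

(** The identity telescopes. Let [t k], [s k] be the terms of the two series and
    [c] the factor of the right-hand one. Then [t k - c * s k = g (k+1) - g k],
    where [g k = - (2 (x + k) + 3 y - 1) / (2 (2 y - 1)) * t k], so the difference
    of the two sides is the limit of [g]. Convergence of both series forces [g]
    to converge, hence [k * t k] to converge; since [t] is summable, the limit
    of [k * t k] can only be [0], by comparison with the harmonic series. No
    asymptotics of the Pochhammer symbols are needed. In the proof [g] is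
    multiplied by [- 2 (2 y - 1)] to clear denominators. *)

Open Scope R_scope.

(** If [l > 0], then eventually [k * a k > l / 2], so each of the [n] terms with [n < k <= 2 n] is
    at least [l / (4 n)] and the block adds at least [l / 4]. Partial sums within [l / 8] of their
    limit differ by less than that. *)
Lemma summable_lim_INR_mult_le_0 (a : nat -> R) (l : R) :
  ex_series a -> is_lim_seq (fun n => INR n * a n) l -> l <= 0.
Proof.
  intros [s Hs] Ha.
  destruct (Rle_lt_dec l 0) as [|Hl]; [assumption|exfalso].
  assert (Hs' : is_lim_seq (sum_n a) s) by exact Hs.
  apply is_lim_seq_spec in Ha.
  assert (Hl2 : 0 < l / 2) by lra.
  assert (Hl8 : 0 < l / 8) by lra.
  destruct (Ha (mkposreal _ Hl2)) as [N1 HN1].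
  apply is_lim_seq_spec in Hs'.
  destruct (Hs' (mkposreal _ Hl8)) as [N2 HN2].
  simpl in HN1, HN2.
  set (n := S (N1 + N2)).
  assert (Hn : 0 < INR n) by (apply lt_0_INR; unfold n; lia).
  assert (Hm : forall m, (m <= n)%nat ->
    sum_n a n + INR m * (l / (4 * INR n)) <= sum_n a (n + m)).
  { induction m as [|m IH]; intros Hmn.
    - rewrite Nat.add_0_r. simpl. lra.
    - rewrite Nat.add_succ_r, sum_Sn, (S_INR m).
      specialize (IH ltac:(lia)).
      assert (Hk : l / (4 * INR n) <= a (S (n + m))).
      { specialize (HN1 (S (n + m)) ltac:(unfold n; lia)).
        apply Rabs_def2 in HN1 as [_ HN1].
        assert (Hk1 : INR (S (n + m)) <= 2 * INR n).
        { replace (2 * INR n) with (INR (n + n)) by (rewrite plus_INR; ring).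
          apply le_INR. lia. }
        assert (Hk0 : 0 < INR (S (n + m))) by (apply lt_0_INR; lia).
        apply Rmult_le_reg_r with (4 * INR n); [lra|].
        replace (l / (4 * INR n) * (4 * INR n)) with l by (field; lra).
        (* Positivity of the term allows the bound [k <= 2 n] to be multiplied by it. *)
        assert (Hapos : 0 < a (S (n + m))).
        { apply Rmult_lt_reg_l with (INR (S (n + m))); lra. }
        apply (Rmult_le_compat_r _ _ _ (Rlt_le _ _ Hapos)) in Hk1. lra. }
      change plus with Rplus. lra. }
  specialize (Hm n (le_n n)).
  replace (INR n * (l / (4 * INR n))) with (l / 4) in Hm by (field; lra).
  assert (H1 := HN2 n ltac:(unfold n; lia)).
  assert (H2 := HN2 (n + n)%nat ltac:(unfold n; lia)).
  apply Rabs_def2 in H1 as [_ H1]. apply Rabs_def2 in H2 as [H2 _]. lra.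
Qed.

Lemma summable_lim_INR_mult (a : nat -> R) (l : R) :
  ex_series a -> is_lim_seq (fun n => INR n * a n) l -> l = 0.
Proof.
  intros Hs Ha. apply Rle_antisym.
  - exact (summable_lim_INR_mult_le_0 a l Hs Ha).
  - enough (- l <= 0) by lra.
    apply summable_lim_INR_mult_le_0 with (fun n => - a n).
    + destruct Hs as [s Hs]. exists (- s). exact (is_series_opp a s Hs).
    + apply is_lim_seq_ext with (fun n => - (INR n * a n)).
      * intros n. ring.
      * exact (proj1 (is_lim_seq_opp _ _) Ha).
Qed.

Lemma is_lim_seq_sum_n_telescope (u : nat -> R) (l : R) :
  is_series (fun k => u (S k) - u k) l -> is_lim_seq u (l + u O).
Proof.
  (* [sum_n] includes the index [n], so the sum collapses to [u (S n) - u 0], hence the shift by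
     one. *)
  intros H. apply is_lim_seq_incr_1.
  apply is_lim_seq_ext with (fun n => sum_n (fun k => u (S k) - u k) n + u O).
  - intros n. induction n as [|n IH].
    + rewrite sum_O. ring.
    + rewrite sum_Sn. change plus with Rplus. lra.
  - apply is_lim_seq_plus'; [exact H | apply is_lim_seq_const].
Qed.

Open Scope C_scope.

Lemma is_series_C_components (u : nat -> C) (l : C) :
  is_series (V := C_NormedModule) u l ->
  is_series (fun k => fst (u k)) (fst l) /\ is_series (fun k => snd (u k)) (snd l).
Proof.
  intros H.
  assert (H' : forall eps : posreal, eventually (fun n =>
     ball (M := C_UniformSpace) l eps (sum_n (G := C_NormedModule) u n))).
  { apply (proj1 (filterlim_locally (F := eventually)
      (sum_n (G := C_NormedModule) u) (l : C_UniformSpace))). exact H. }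
  split; apply (proj2 (filterlim_locally _ _));
    intros eps; generalize (H' eps); apply filter_imp; intros n [H1 H2].
  - rewrite fst_sum_n in H1. exact H1.
  - rewrite snd_sum_n in H2. exact H2.
Qed.

(** Telescoping gives [g n -> l + g 0]. As [t n -> 0], the part [b * t n] vanishes and
    [n * t n -> (l + g 0) / 2], which summability of [t] forces to be [0]. The real and imaginary
    parts are treated separately, since the harmonic comparison uses the order of the reals. *)
Lemma telescoping_limit (t g : nat -> C) (b l : C) :
  ex_series (V := C_NormedModule) t ->
  (forall n, g n = (2 * INR n + b) * t n) ->
  is_series (V := C_NormedModule) (fun n => g (S n) - g n) l ->
  l = - g O.
Proof.
  intros [s Hs] Hg Hl.
  destruct (is_series_C_components _ _ Hs) as [Hs1 Hs2].
  destruct (is_series_C_components _ _ Hl) as [Hl1 Hl2].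
  apply (is_lim_seq_sum_n_telescope (fun n => fst (g n))) in Hl1.
  apply (is_lim_seq_sum_n_telescope (fun n => snd (g n))) in Hl2.
  assert (Ht1 := ex_series_lim_0 _ (ex_intro _ _ Hs1)).
  assert (Ht2 := ex_series_lim_0 _ (ex_intro _ _ Hs2)).
  assert (E1 : (fst l + fst (g O) = 0)%R).
  { enough ((fst l + fst (g O)) / 2 = 0)%R by lra.
    apply (summable_lim_INR_mult (fun n => fst (t n))); [eexists; exact Hs1|].
    apply is_lim_seq_ext with (fun n => (/ 2 *
      (fst (g n) - (fst b * fst (t n) - snd b * snd (t n))))%R).
    { intros n. rewrite Hg. simpl. field. }
    (* The limit is rewritten in the shape that the limit rules produce, with [0] for the limits of
       both components of [t]. *)
    replace (Finite ((fst l + fst (g O)) / 2)%R) with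
      (Rbar_mult (Finite (/ 2)%R) (Finite (fst l + fst (g O) - (fst b * 0 - snd b * 0))%R))
      by (simpl; f_equal; field).
    apply is_lim_seq_scal_l, is_lim_seq_minus'; [exact Hl1|].
    apply is_lim_seq_minus'.
    - exact (is_lim_seq_scal_l _ (fst b) _ Ht1).
    - exact (is_lim_seq_scal_l _ (snd b) _ Ht2). }
  assert (E2 : (snd l + snd (g O) = 0)%R).
  { enough ((snd l + snd (g O)) / 2 = 0)%R by lra.
    apply (summable_lim_INR_mult (fun n => snd (t n))); [eexists; exact Hs2|].
    apply is_lim_seq_ext with (fun n => (/ 2 *
      (snd (g n) - (fst b * snd (t n) + snd b * fst (t n))))%R).
    { intros n. rewrite Hg. simpl. field. }
    replace (Finite ((snd l + snd (g O)) / 2)%R) with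
      (Rbar_mult (Finite (/ 2)%R) (Finite (snd l + snd (g O) - (fst b * 0 + snd b * 0))%R))
      by (simpl; f_equal; field).
    apply is_lim_seq_scal_l, is_lim_seq_minus'; [exact Hl2|].
    apply is_lim_seq_plus'.
    - exact (is_lim_seq_scal_l _ (fst b) _ Ht2).
    - exact (is_lim_seq_scal_l _ (snd b) _ Ht1). }
  destruct l as [l1 l2], (g O) as [g1 g2]; simpl in *.
  unfold Copp; simpl. f_equal; lra.
Qed.

Lemma pochhammer_1 (k : nat) : pochhammer 1 k = INR (fact k).
Proof.
  induction k as [|k IH]; [reflexivity|].
  change (pochhammer 1 (S k)) with (pochhammer 1 k * (1 + INR k)).
  rewrite IH, fact_simpl, mult_INR, S_INR, RtoC_mult, RtoC_plus. ring.
Qed.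

(** Both sides are [pochhammer a (S k)], with the first or the last factor split off. *)
Lemma pochhammer_shift (a : C) (k : nat) :
  a * pochhammer (a + 1) k = pochhammer a k * (a + INR k).
Proof.
  induction k as [|k IH]; simpl pochhammer.
  - simpl. ring.
  - rewrite Cmult_assoc, IH, S_INR, RtoC_plus. ring.
Qed.

Lemma Cpow_1_l (k : nat) : Cpow 1 k = 1.
Proof. induction k as [|k IH]; simpl; [reflexivity|rewrite IH; ring]. Qed.

(** The upper parameter [1] contributes [k!], which cancels the factorial of the series. *)
Lemma hypergeom_term_3F2_1 (a b c d : C) (k : nat) :
  pochhammer c k <> 0 -> pochhammer d k <> 0 ->
  hypergeom_term [a; b; RtoC 1] [c; d] 1 k
  = pochhammer a k * pochhammer b k / (pochhammer c k * pochhammer d k).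
Proof.
  intros Hc Hd. unfold hypergeom_term, Cprod; simpl map; simpl fold_right.
  rewrite pochhammer_1, Cpow_1_l. field.
  repeat split; auto. intros H. apply RtoC_inj in H. exact (INR_fact_neq_0 k H).
Qed.

Theorem theorem2 (x y : C)
  (hL : hypergeom_cvg [x; x + 1; RtoC 1] [x + y; x + y + 1] 1)
  (hR : hypergeom_cvg [x; x + 1; RtoC 1] [x + y + 1; x + y + 2] 1)
  (hy : 2 * y - 1 <> 0) :
  hypergeom [x; x + 1; RtoC 1] [x + y; x + y + 1] 1
  = (2 * x + 3 * y - 1) / (2 * (2 * y - 1))
    + ((y - 1) * y * (y + 1))
      / (2 * (2 * y - 1) * (x + y) * (x + y + 1))
      * hypergeom [x; x + 1; RtoC 1] [x + y + 1; x + y + 2] 1.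
Proof.
  assert (HsL := hypergeom_correct _ _ _ hL).
  assert (HsR := hypergeom_correct _ _ _ hR).
  set (T := hypergeom _ [x + y; x + y + 1] 1) in *.
  set (S' := hypergeom _ [x + y + 1; x + y + 2] 1) in *.
  destruct hL as [pL _]. destruct hR as [pR _].
  assert (p0 : forall k, pochhammer (x + y) k <> 0) by (apply pL; simpl; auto).
  assert (p1 : forall k, pochhammer (x + y + 1) k <> 0) by (apply pL; simpl; auto).
  assert (p2 : forall k, pochhammer (x + y + 2) k <> 0) by (apply pR; simpl; auto).
  (* [x + y + k] is the last factor of the nonzero [pochhammer (x + y) (S k)]. *)
  assert (n0 : forall k : nat, x + y + INR k <> 0).
  { intros k H. apply (p0 (S k)). simpl. rewrite H. ring. }
  assert (n1 : forall k : nat, x + y + INR k + 1 <> 0).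
  { intros k H. apply (n0 (S k)). rewrite S_INR, RtoC_plus, Cplus_assoc. exact H. }
  assert (m0 : x + y <> 0).
  { intros H. apply (n0 O). simpl. rewrite H. ring. }
  assert (m1 : x + y + 1 <> 0).
  { intros H. apply (n0 1%nat). exact H. }
  assert (c2 : RtoC 2 <> 0) by (intros H; apply RtoC_inj in H; lra).
  set (t := hypergeom_term [x; x + 1; RtoC 1] [x + y; x + y + 1] 1) in *.
  set (s := hypergeom_term [x; x + 1; RtoC 1] [x + y + 1; x + y + 2] 1) in *.
  set (c := (y - 1) * y * (y + 1)
      / (2 * (2 * y - 1) * (x + y) * (x + y + 1))).
  assert (Hs : forall k, s k = t k * ((x + y) * (x + y + 1))
                 / ((x + y + INR k) * (x + y + INR k + 1))).
  { intros k. unfold s, t. rewrite !hypergeom_term_3F2_1 by auto.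
    assert (q1 : pochhammer (x + y + 1) k
        = pochhammer (x + y) k * (x + y + INR k) / (x + y)).
    { rewrite <- pochhammer_shift. field. exact m0. }
    assert (q2 : pochhammer (x + y + 2) k
        = pochhammer (x + y + 1) k * (x + y + INR k + 1) / (x + y + 1)).
    { replace (x + y + INR k + 1) with (x + y + 1 + INR k) by ring.
      rewrite <- pochhammer_shift.
      replace (x + y + 1 + 1) with (x + y + 2) by ring.
      field. exact m1. }
    rewrite q2, q1. field. repeat split; auto. }
  assert (Ht : forall k, t (S k) = t k * ((x + INR k) * (x + 1 + INR k))
                 / ((x + y + INR k) * (x + y + INR k + 1))).
  { intros k. unfold t. rewrite !hypergeom_term_3F2_1 by auto. simpl pochhammer.
    replace (x + y + 1 + INR k) with (x + y + INR k + 1) by ring.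
    field. repeat split; auto. }
  set (g := fun n : nat => (2 * INR n + (2 * x + 3 * y - 1)) * t n).
  (* With [a = x + k], clearing denominators leaves the polynomial identity [(2a+3y+1) a (a+1) -
     (2a+3y-1) (a+y) (a+y+1) = (y-1) y (y+1) - 2 (2y-1) (a+y) (a+y+1)]. *)
  assert (Hg : forall k, g (S k) - g k
                 = - (2 * (2 * y - 1)) * (t k - c * s k)).
  { intros k. unfold g. rewrite Ht, Hs, S_INR, RtoC_plus. unfold c. field.
    repeat split; auto. }
  assert (Hlim : - (2 * (2 * y - 1)) * (T - c * S') = - g O).
  { apply (telescoping_limit t g (2 * x + 3 * y - 1)).
    - exists T. exact HsL.
    - reflexivity.
    - refine (is_series_ext _ _ _ (fun n => eq_sym (Hg n)) _).
      apply (is_series_scal (V := C_NormedModule) (- (2 * (2 * y - 1)))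
        (fun k => t k - c * s k)).
      apply (is_series_minus (V := C_NormedModule) t (fun k => c * s k));
        [exact HsL|].
      exact (is_series_scal (V := C_NormedModule) c s _ HsR). }
  assert (Hg0 : g O = 2 * x + 3 * y - 1).
  { unfold g, t. rewrite hypergeom_term_3F2_1 by auto. simpl. field. }
  rewrite Hg0 in Hlim.
  (* By [Hlim] this is the value of [g 0]; after the substitution the goal is
     [T = (T - c * S') + c * S']. *)
  replace (2 * x + 3 * y - 1) with (2 * (2 * y - 1) * (T - c * S')).
  - field. exact hy.
  - transitivity (- (- (2 * (2 * y - 1)) * (T - c * S'))); [ring|rewrite Hlim; ring].
Qed.
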